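(* Let $R$ be a unital, semi-primitive exchange ring. An element of the set $R^r$ of von Neumann regular elements of $R$ is maximal with respect to the order $\le$ if and only if it belongs to $R_q^{-1}$.
   Context: Rings are associative. A unital ring $R$ is an exchange ring if for every $a\in R$ there is an idempotent $p\in aR$ such that $1-p\in(1-a)R$. Semi-primitive means that the Jacobson radical is zero. For $s,t\in R$ write $s\perp t$ if $sRt=0=tRs$. $u\in R$ is quasi-invertible, $u\in R_q^{-1}$, if there exist $c,d\in R$ with $(1-uc)\perp(1-du)$; such elements are von Neumann regular. $R^r$ is the set of $a\in R$ with $a=axa$ for some $x\in R$. For $a,b\in R^r$, $a\le b$ ($b$ extends $a$) means that there is $x\in R$ with $a=axb=bxa=axa$; this is a partial order on $R^r$. *)

(* Defs.v *)
From mathcomp Require Import all_boot all_algebra.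
From mathcomp Require Import boolp classical_sets.

Set Implicit Arguments.
Unset Strict Implicit.
Unset Printing Implicit Defensive.

Import GRing.Theory.

Local Open Scope classical_set_scope.
Local Open Scope ring_scope.

(* Unital rings are [pzRingType]s: not necessarily commutative, and the zero
   ring is allowed. *)

Definition exchange_ring (R : pzRingType) : Prop :=
  forall a : R, exists p : R,
    [/\ p * p = p,
        exists x : R, p = a * x
      & exists y : R, 1 - p = (1 - a) * y].

Definition left_ideal (R : pzRingType) (I : set R) : Prop :=
  [/\ I 0,
      forall x y : R, I x -> I y -> I (x + y)
    & forall r x : R, I x -> I (r * x)].

Definition maximal_left_ideal (R : pzRingType) (M : set R) : Prop :=
  [/\ left_ideal M,
      M <> setT
    & forall I : set R, left_ideal I -> M `<=` I -> I = M \/ I = setT].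

Definition jacobson_radical (R : pzRingType) : set R :=
  \bigcap_(M in @maximal_left_ideal R) M.
Arguments jacobson_radical R : clear implicits.

Definition semi_primitive (R : pzRingType) : Prop :=
  jacobson_radical R = [set 0].

Definition perp (R : pzRingType) (s t : R) : Prop :=
  (forall r : R, s * r * t = 0) /\ (forall r : R, t * r * s = 0).

Definition quasi_invertible (R : pzRingType) : set R :=
  [set u | exists c d : R, perp (1 - u * c) (1 - d * u)].
Arguments quasi_invertible R : clear implicits.

Definition vn_regular (R : pzRingType) : set R :=
  [set a | exists x : R, a = a * x * a].
Arguments vn_regular R : clear implicits.

(* [vn_le a b] reads "b extends a"; it is a partial order only on
   [vn_regular R]. *)
Definition vn_le (R : pzRingType) (a b : R) : Prop :=
  exists x : R, [/\ a = a * x * b, a = b * x * a & a = a * x * a].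

Definition maximal_in (T : Type) (A : set T) (le : T -> T -> Prop) (a : T)
    : Prop :=
  A a /\ forall b : T, A b -> le a b -> b = a.

(* Main.v *)
Require Import Defs.
From mathcomp Require Import all_boot all_algebra.
From mathcomp Require Import boolp classical_sets.

(* If a = axa, x = xax and v is a nonzero regular element of
   (1 - ax)R(1 - xa), then a + v properly extends a. In a semi-primitive
   exchange ring every nonzero right ideal tR contains a nonzero idempotent ty,
   and then tyt is a nonzero regular element; so a maximal a has
   (1 - ax)R(1 - xa) = 0. Conversely, if b extends a through x, then
   b - a lies in (1 - ax)R(1 - xa), and this is contained in
   (1 - ax)(1 - ac)R(1 - da)(1 - xa), which vanishes when a is
   quasi-invertible. *)

Set Implicit Arguments.
Unset Strict Implicit.
Unset Printing Implicit Defensive.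

Import GRing.Theory.

Local Open Scope ring_scope.

Lemma left_ideal_add_principal (R : pzRingType) (M : set R) (t : R) :
  left_ideal M -> left_ideal [set z | exists r m, M m /\ z = r * t + m].
Proof.
move=> [M0 MD MM]; split.
- by exists 0, 0; rewrite mul0r addr0.
- move=> _ _ [r [m [Mm ->]]] [s [n [Mn ->]]].
  exists (r + s), (m + n); split; first exact: MD.
  by rewrite mulrDl addrACA.
- move=> s _ [r [m [Mm ->]]]; exists (s * r), (s * m); split; first exact: MM.
  by rewrite mulrDr mulrA.
Qed.

(** The formula comes from the formal geometric series: the inverse of [1 - z * t] is [1] plus [z]
    times the inverse of [1 - t * z] times [t]. *)
Lemma left_inverse_one_sub_mul_swap (R : pzRingType) (t z w : R) :
  w * (1 - t * z) = 1 -> (1 + z * w * t) * (1 - z * t) = 1.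
Proof.
move=> wK.
have -> : (1 + z * w * t) * (1 - z * t)
    = 1 - z * t + z * (w * (1 - t * z)) * t.
  by rewrite mulrDl mul1r !mulrBr !mulr1 mulrBl !mulrA.
by rewrite wK mulr1 subrK.
Qed.

(** Bridges the radical, defined by left ideals, and the right inverses that exchange supplies. If a
    maximal [M] misses [t], then [1 = z * t + m] with [m] in [M], and left invertibility of
    [m = 1 - z * t] forces [M] to be everything. *)
Lemma jacobson_radical_right_inverses (R : pzRingType) (t : R) :
  (forall z, exists w, (1 - t * z) * w = 1) -> jacobson_radical R t.
Proof.
move=> rinv M [Mideal MneT Mmax]; apply: contrapT => Mt.
have [M0 _ MM] := Mideal.
have Iideal := @left_ideal_add_principal R M t Mideal.
have IM : forall x, M x -> exists r m, M m /\ x = r * t + m.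
  by move=> x Mx; exists 0, x; rewrite mul0r add0r.
have [IeqM|IeqT] := Mmax _ Iideal IM.
  apply: Mt; rewrite -IeqM; exists 1, 0.
  by rewrite mul1r addr0.
have [z [m [Mm zm]]] : exists r m, M m /\ 1 = r * t + m.
  by have : (@setT R) 1 by []; rewrite -IeqT.
have [w wK] := rinv z.
(* The right inverse w has the form 1 - t z', so it is right invertible too,
   hence a two-sided inverse of 1 - tz. *)
have wE : w = 1 - t * (- (z * w)).
  by rewrite mulrN opprK mulrA -wK mulrBl mul1r subrK.
have [w' w'K] := rinv (- (z * w)).
rewrite -wE in w'K.
have Kw : w * (1 - t * z) = 1.
  suff -> : 1 - t * z = w' by [].
  by rewrite -[w']mul1r -[X in X * w']wK -mulrA w'K mulr1.
apply: MneT; apply/seteqP; split=> // y _.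
have mE : m = 1 - z * t by rewrite zm addrAC subrr add0r.
have -> : y = y * (1 + z * w * t) * m.
  by rewrite mE -mulrA left_inverse_one_sub_mul_swap // mulr1.
exact: MM.
Qed.

Section SemiPrimitiveExchange.

Variable R : pzRingType.
Hypotheses (R_exchange : exchange_ring R) (R_semi_primitive : semi_primitive R).

(** If [0] is the only idempotent in [tR], exchange applied to [t * z] gives [p = 0], so [1 - t * z]
    is right invertible for every [z] and [t] lies in the radical. *)
Lemma exists_nonzero_idempotent (t : R) :
  t <> 0 -> exists y, t * y * (t * y) = t * y /\ t * y <> 0.
Proof.
move=> t0; apply: contrapT => noidem; apply: t0.
suff : jacobson_radical R t by rewrite R_semi_primitive.
apply: jacobson_radical_right_inverses => z.
have [p [pp [x pE] [w wE]]] := R_exchange (t * z).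
exists w; rewrite -wE; suff -> : p = 0 by rewrite subr0.
apply: contrapT => p0; apply: noidem; exists (z * x).
by rewrite (mulrA t) -pE.
Qed.

Lemma semiprime (u : R) : (forall r, u * r * u = 0) -> u = 0.
Proof.
move=> uRu; apply: contrapT => /exists_nonzero_idempotent[y [yy]]; apply.
by rewrite -yy mulrA uRu mul0r.
Qed.

(** By semiprimeness: [(t * r * s) * q * (t * r * s)] contains the factor [s * q * t]. *)
Lemma perpP (s t : R) : (forall r, s * r * t = 0) -> perp s t.
Proof.
move=> sRt; split=> // r; apply: semiprime => q.
have -> : t * r * s * q * (t * r * s) = t * r * (s * q * t) * (r * s).
  by rewrite !mulrA.
by rewrite sRt mulr0 mul0r.
Qed.

Lemma exists_regular_multiple (t : R) :
  t <> 0 -> exists y, let v := t * y * t in v <> 0 /\ v * y * v = v.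
Proof.
move=> /exists_nonzero_idempotent[y [yy y0]]; exists y; split.
  by move=> v0; apply: y0; rewrite -yy mulrA v0 mul0r.
have -> : t * y * t * y * (t * y * t) = t * y * (t * y) * (t * y) * t.
  by rewrite !mulrA.
by rewrite !yy.
Qed.

End SemiPrimitiveExchange.

Lemma reflexive_inverse (R : pzRingType) (a : R) :
  vn_regular R a -> exists x, a * x * a = a /\ x * a * x = x.
Proof.
move=> [x ax]; exists (x * a * x); split; first by rewrite !mulrA -!ax.
have -> : x * a * x * a * (x * a * x) = x * (a * x * a * x * a) * x.
  by rewrite !mulrA.
by rewrite -!ax.
Qed.

Lemma orthogonal_extension (R : pzRingType) (a x v y : R) :
  a * x * a = a -> x * a * x = x ->
  v * (x * a) = 0 -> a * x * v = 0 -> v * y * v = v ->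
  vn_regular R (a + v) /\ vn_le a (a + v).
Proof.
move=> axa xax vxa axv vyv.
have vx : v * x = 0 by rewrite -xax mulrA vxa mul0r.
have xv : x * v = 0 by rewrite -xax -!mulrA (mulrA a) axv mulr0.
split; last first.
  by exists x; rewrite mulrDr mulrDl mulrDl axv vx mul0r !addr0 axa.
(* Compressing [y] by [1 - x * a] and [1 - a * x] kills its products with [a] on both sides and
   keeps it an inner inverse of [v], so all cross terms vanish. *)
exists (x + (1 - x * a) * y * (1 - a * x)).
set w := (1 - x * a) * y * (1 - a * x).
have aw : a * w = 0.
  by rewrite /w !mulrA (mulrBr a) mulr1 (mulrA a) axa subrr !mul0r.
have wa : w * a = 0 by rewrite /w -mulrA (mulrBl a) mul1r axa subrr mulr0.
have vw : v * w * v = v.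
  have -> : v * w * v = v * (1 - x * a) * y * ((1 - a * x) * v).
    by rewrite /w !mulrA.
  by rewrite mulrBr mulr1 vxa subr0 mulrBl mul1r axv subr0.
rewrite mulrDl !mulrDr aw vx addr0 add0r !mulrDl axa axv.
by rewrite -(mulrA v w a) wa mulr0 addr0 add0r vw.
Qed.

Lemma maximal_quasi_invertible (R : pzRingType)
    (R_exchange : exchange_ring R) (R_semi_primitive : semi_primitive R)
    (a : R) :
  maximal_in (vn_regular R) (@vn_le R) a -> quasi_invertible R a.
Proof.
move=> [a_regular amax]; have [x [axa xax]] := reflexive_inverse a_regular.
exists x, x; apply: perpP => // r; set t := _ * (1 - x * a).
apply: contrapT => /(exists_regular_multiple R_exchange R_semi_primitive).
move=> [y [v0 vyv]]; set v := t * y * t in v0 vyv.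
have vxa : v * (x * a) = 0.
  have : (1 - x * a) * (x * a) = 0 by rewrite mulrBl mul1r mulrA xax subrr.
  by rewrite /v /t -!mulrA => ->; rewrite !mulr0.
have axv : a * x * v = 0.
  have : a * x * (1 - a * x) = 0 by rewrite mulrBr mulr1 mulrA axa subrr.
  by rewrite /v /t !mulrA => ->; rewrite !mul0r.
have [breg ab] := orthogonal_extension axa xax vxa axv vyv.
by apply: v0; apply: (addrI a); rewrite addr0; apply: amax.
Qed.

Lemma quasi_invertible_maximal (R : pzRingType) (a : R) :
  vn_regular R a -> quasi_invertible R a ->
  maximal_in (vn_regular R) (@vn_le R) a.
Proof.
move=> a_regular [c [d [cRd _]]]; split=> // b _ [x [axb bxa axa]].
apply/eqP; rewrite -subr_eq0; apply/eqP.
have -> : b - a = (1 - a * x) * b * (1 - x * a).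
  by rewrite mulrBl mul1r -axb mulrBr mulr1 mulrBl !mulrA -bxa -axa subrr subr0.
(* Since [(1 - a * x) * a = 0], the factor [1 - a * c] can be inserted for free; [1 - d * a] enters
   symmetrically. *)
have -> : 1 - a * x = (1 - a * x) * (1 - a * c).
  by rewrite [RHS]mulrBr mulr1 mulrA (mulrBl a) mul1r -axa subrr mul0r subr0.
have -> : 1 - x * a = (1 - d * a) * (1 - x * a).
  by rewrite [RHS]mulrBl mul1r -mulrA (mulrBr a) mulr1 mulrA -axa subrr mulr0
    subr0.
have -> (p q r s : R) : p * q * b * (r * s) = p * (q * b * r) * s.
  by rewrite !mulrA.
by rewrite cRd mulr0 mul0r.
Qed.

Theorem proposition8p2 (R : pzRingType)
    (R_exchange : exchange_ring R) (R_semi_primitive : semi_primitive R)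
    (a : R) (a_regular : vn_regular R a) :
  maximal_in (vn_regular R) (@vn_le R) a <-> quasi_invertible R a.
Proof.
split; first exact: maximal_quasi_invertible.
exact: quasi_invertible_maximal.
Qed.
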